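(* Let $\mathcal A$ be a $^*$-algebra over $\mathsf C$ with approximate identity and let $\mathcal I$ be a $^*$-ideal of $\mathcal A$ contained in $\mathcal J_{\mathrm{min}}(\mathcal A)$ but $\mathcal I\neq\mathcal J_{\mathrm{min}}(\mathcal A)$. Then $\mathcal A/\mathcal I$ and $\mathcal A/\mathcal J_{\mathrm{min}}(\mathcal A)$ have isomorphic categories of $^*$-representations, isomorphic categories of strongly non-degenerate $^*$-representations, and isomorphic lattices of closed $^*$-ideals, but they are not formally Morita equivalent.
   Context: $\mathsf R$ is an ordered ring: an associative commutative ring with $1\neq 0$ and a subset $\mathsf P$ such that $\mathsf R$ is the disjoint union $-\mathsf P\cup\{0\}\cup\mathsf P$ and $\mathsf P+\mathsf P,\ \mathsf P\cdot\mathsf P\subseteq\mathsf P$ (write $a>b$ if $a-b\in\mathsf P$). $\mathsf C=\mathsf R(\mathrm i)$ with $\mathrm i^2=-1$, with the usual conjugation. A $^*$-algebra over $\mathsf C$ is an associative (not necessarily unital) $\mathsf C$-algebra with an antilinear involutive anti-automorphism $^*$. A $^*$-ideal is a two-sided ideal (and $\mathsf C$-submodule) closed under $^*$. An approximate identity of $\mathcal A$ consists of a filtration $\mathcal A=\bigcup_{\alpha\in I}\mathcal A_\alpha$ by $\mathsf C$-submodules indexed by a directed set $I$ (increasing in $\alpha$) and elements $E_\alpha=E_\alpha^*\in\mathcal A$ with $E_\alpha E_\beta=E_\alpha=E_\beta E_\alpha$ for $\alpha<\beta$ and $E_\alpha A=A=AE_\alpha$ for all $A\in\mathcal A_\alpha$.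 A pre-Hilbert space over $\mathsf C$ is a $\mathsf C$-module $\mathfrak H$ with a positive-definite Hermitian product with values in $\mathsf C$, linear in the second argument; $\mathfrak B(\mathfrak H)$ is the $^*$-algebra of all $A\in\mathrm{End}_{\mathsf C}(\mathfrak H)$ having an adjoint. A $^*$-representation of $\mathcal A$ is a $^*$-homomorphism $\pi:\mathcal A\to\mathfrak B(\mathfrak H)$; it is strongly non-degenerate if the $\mathsf C$-span of all $\pi(A)\phi$ is $\mathfrak H$. The categories of $^*$-representations have isometric intertwiners as morphisms. A linear functional $\omega:\mathcal A\to\mathsf C$ is positive if $\omega(A^*A)\ge 0$ for all $A$; $\mathcal A^+$ is the set of Hermitian $A\in\mathcal A$ with $\omega(A)\ge0$ for all positive $\omega$. All modules carry a compatible $\mathsf C$-module structure. A closed $^*$-ideal of $\mathcal A$ is the kernel of some $^*$-representation of $\mathcal A$ on a pre-Hilbert space over $\mathsf C$; $\mathcal J_{\mathrm{min}}(\mathcal A)$ is the intersection of all closed $^*$-ideals (again a closed $^*$-ideal). Closed $^*$-ideals form a lattice ordered by inclusion, with meet the intersection and join the smallest closed $^*$-ideal containing the union. Formal Morita equivalence. For a right $\mathcal A$-module $\mathfrak X$, an $\mathcal A$-valued inner product is a map $\langle\cdot,\cdot\rangle_{\mathcal A}:\mathfrak X\times\mathfrak X\to\mathcal A$ that is $\mathsf C$-linear and right $\mathcal A$-linear in the second argument with $\langle x,y\rangle_{\mathcal A}=\langle y,x\rangle_{\mathcal A}^*$. It is positive semi-definite if $\langle x,x\rangle_{\mathcal A}\in\mathcal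 A^+$ for all $x$, and full if the $\mathsf C$-span of all $\langle x,y\rangle_{\mathcal A}$ is $\mathcal A$. For a left $\mathcal B$-module, ${}_{\mathcal B}\langle\cdot,\cdot\rangle$ is analogous with linearity in the first argument. $^*$-algebras $\mathcal A$ and $\mathcal B$ are formally Morita equivalent if there is a $(\mathcal B$-$\mathcal A)$-bimodule $\mathfrak X$ with full positive semi-definite inner products $\langle\cdot,\cdot\rangle_{\mathcal A}$ and ${}_{\mathcal B}\langle\cdot,\cdot\rangle$ such that: $\langle B\cdot x,y\rangle_{\mathcal A}=\langle x,B^*\cdot y\rangle_{\mathcal A}$ and ${}_{\mathcal B}\langle x\cdot A,y\rangle={}_{\mathcal B}\langle x,y\cdot A^*\rangle$; $x\cdot\langle y,z\rangle_{\mathcal A}={}_{\mathcal B}\langle x,y\rangle\cdot z$; property P: for every $^*$-representation $(\pi,\mathfrak H)$ of $\mathcal A$ the Hermitian product on $\mathfrak X\otimes_{\mathcal A}\mathfrak H$ determined by $\langle x\otimes\psi,y\otimes\phi\rangle=\langle\psi,\pi(\langle x,y\rangle_{\mathcal A})\phi\rangle_{\mathfrak H}$ is positive semi-definite; property Q: the conjugate $(\mathcal A$-$\mathcal B)$-bimodule $\overline{\mathfrak X}$ (same additive group, elements $\overline x$, with $z\overline x=\overline{\overline zx}$, $A\cdot\overline x=\overline{x\cdot A^*}$, $\overline x\cdot B=\overline{B^*\cdot x}$, $\langle\overline x,\overline y\rangle_{\mathcal B}={}_{\mathcal B}\langle x,y\rangle$) has property P with respect to $\mathcal B$. *)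

(* Defs.v *)
From HB Require Import structures.
From mathcomp Require Import all_boot all_order all_algebra.
From mathcomp Require Import generic_quotient ring_quotient.
From mathcomp Require Import boolp classical_sets functions.
From mathcomp Require Import complex freeg.

Set Implicit Arguments.
Unset Strict Implicit.
Unset Printing Implicit Defensive.

Import Order.TTheory GRing.Theory Num.Theory.
Import Quotient.

Local Open Scope classical_set_scope.
Local Open Scope quotient_scope.
Local Open Scope ring_scope.

(* An ordered ring is a [realDomainType]: trichotomy makes it an integral      *)
(* domain, and its norm and its set of units are determined by the ring and   *)
(* the order, so this structure adds no hypothesis.                           *)

(* The ring C = R(i).  The library makes [R[i]] a ring only when [R] is a     *)
(* field, hence the alias, with the multiplication [mulc] of the library.     *)
Definition cext (R : realDomainType) : Type := complex R.

Section CExt.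
Variable R : realDomainType.

HB.instance Definition _ := GRing.Zmodule.copy (cext R) (complex R).

Definition cone : cext R := Complex 1 0.

Lemma cext_mul1 : left_id cone (@ComplexField.mulc R).
Proof. by case=> a b /=; rewrite !mul1r !mul0r subr0 addr0. Qed.

Lemma cext_mulDl : left_distributive (@ComplexField.mulc R) +%R.
Proof.
move=> [a b] [c d] [e f]; rewrite /GRing.add /= /ComplexField.addc /=.
rewrite !mulrDl !opprD -!addrA.
by congr Complex; congr (_ + _); rewrite addrCA.
Qed.

Lemma cext_one_neq0 : cone != 0.
Proof. by rewrite eq_complex /= oner_eq0. Qed.

HB.instance Definition _ := GRing.Zmodule_isComNzRing.Build (cext R)
  (@ComplexField.mulcA R) (@ComplexField.mulcC R)
  cext_mul1 cext_mulDl cext_one_neq0.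

Definition cbar (z : cext R) : cext R := conjc z.

Lemma cbarK : involutive cbar.
Proof. by case=> a b; rewrite /cbar /= opprK. Qed.

Lemma cbarD z w : cbar (z + w) = cbar z + cbar w.
Proof. by case: z w => a b [c d]; congr Complex; rewrite opprD. Qed.

Lemma cbarM z w : cbar (z * w) = cbar z * cbar w.
Proof.
case: z w => a b [c d]; congr Complex.
  by rewrite mulrNN.
by rewrite opprD mulrN mulNr.
Qed.

Lemma cbar1 : cbar 1 = 1.
Proof. by congr Complex; rewrite oppr0. Qed.

Definition cge0 (z : cext R) : Prop := complex.Im z = 0 /\ 0 <= complex.Re z.
Definition cgt0 (z : cext R) : Prop := complex.Im z = 0 /\ 0 < complex.Re z.

End CExt.

Section Submodules.
Variables (R : realDomainType) (V : lmodType (cext R)).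

Definition submodule (W : set V) : Prop :=
  W 0 /\ forall (z : cext R) u v, W u -> W v -> W (z *: u + v).

Definition cspan (S : set V) : set V :=
  [set v | exists n (z : 'I_n -> cext R) (s : 'I_n -> V),
     (forall i, S (s i)) /\ v = \sum_(i < n) z i *: s i].

Lemma cspan_submodule S : submodule (cspan S).
Proof.
split.
  exists 0, (fun=> 0), (fun=> 0); split; first by case.
  by rewrite big_ord0.
move=> z _ _ [n [a [s [Ss ->]]]] [m [b [t [St ->]]]].
exists (n + m)%N,
  (fun i : 'I_(n + m) => match fintype.split i with inl j => z * a j | inr j => b j end),
  (fun i : 'I_(n + m) => match fintype.split i with inl j => s j | inr j => t j end); split.
  by move=> i; case: (fintype.split i).
rewrite big_split_ord /= scaler_sumr; congr (_ + _); apply: eq_bigr => i _.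
  by rewrite (unsplitK (inl i)) scalerA.
by rewrite (unsplitK (inr i)).
Qed.

End Submodules.

Section ModuleQuotient.
Variables (R : realDomainType) (V : lmodType (cext R)) (W : set V).
Hypothesis subW : submodule W.

Definition submod_pred of submodule W : {pred V} := fun v => `[< W v >].
Local Notation P := (submod_pred subW).

Lemma submod_pred_zmod_closed : zmod_closed P.
Proof.
case: (subW) => W0 WD; split; first exact/asboolP.
move=> u v /asboolP Wu /asboolP Wv; apply/asboolP.
by rewrite addrC -scaleN1r; apply: WD.
Qed.

HB.instance Definition _ :=
  GRing.isZmodClosed.Build V P submod_pred_zmod_closed.

Definition modquot : Type := {quot P}.
HB.instance Definition _ := GRing.Zmodule.on modquot.

Definition mproj (v : V) : modquot := \pi_{quot P} v.

Lemma mproj_eq u v : mproj u = mproj v <-> W (u - v).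
Proof.
split=> [/eqP|Wuv]; first by rewrite -idealrBE => /asboolP.
by apply/eqP; rewrite -idealrBE; apply/asboolP.
Qed.

Lemma mproj_surj q : exists v, mproj v = q.
Proof. by exists (repr q); rewrite /mproj reprK. Qed.

Lemma mprojD u v : mproj (u + v) = mproj u + mproj v.
Proof. exact: raddfD. Qed.

Definition mscale (z : cext R) (q : modquot) : modquot :=
  mproj (z *: (repr q : V)).

Lemma mprojZ z v : mproj (z *: v) = mscale z (mproj v).
Proof.
apply/mproj_eq; rewrite -scalerBr -[X in W X]addr0; apply: (proj2 subW).
  by apply/mproj_eq; rewrite /mproj reprK.
exact: (proj1 subW).
Qed.

Lemma mscaleA a b q : mscale a (mscale b q) = mscale (a * b) q.
Proof. by have [v <-] := mproj_surj q; rewrite -!mprojZ scalerA. Qed.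

Lemma mscale1 : left_id 1 mscale.
Proof. by move=> q; have [v <-] := mproj_surj q; rewrite -mprojZ scale1r. Qed.

Lemma mscaleDr : right_distributive mscale +%R.
Proof.
move=> a p q; have [u <-] := mproj_surj p; have [v <-] := mproj_surj q.
by rewrite -mprojD -!mprojZ -mprojD scalerDr.
Qed.

Lemma mscaleDl q : {morph mscale^~ q : a b / a + b}.
Proof.
by move=> a b; have [v <-] := mproj_surj q; rewrite -!mprojZ -mprojD scalerDl.
Qed.

HB.instance Definition _ := GRing.Zmodule_isLmodule.Build (cext R) modquot
  mscaleA mscale1 mscaleDr mscaleDl.

Lemma mproj_linear : linear mproj.
Proof. by move=> z u v; rewrite mprojD mprojZ. Qed.

End ModuleQuotient.

(* The library has no non-unital rings, so the product is part of the mixin.  *)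
HB.mixin Record isStarAlgebra (R : realDomainType) A
    of GRing.Lmodule (cext R) A := {
  amul : A -> A -> A;
  astar : A -> A;
  amulA : associative amul;
  amul_linearl : forall b, linear (amul^~ b);
  amul_linearr : forall a, linear (amul a);
  astar_antilinear : forall z a b,
    astar (z *: a + b) = cbar z *: astar a + astar b;
  astarK : involutive astar;
  astarM : forall a b, astar (amul a b) = amul (astar b) (astar a)
}.

#[short(type="starAlgType")]
HB.structure Definition StarAlgebra (R : realDomainType) :=
  { A of GRing.Lmodule (cext R) A & isStarAlgebra R A }.

Declare Scope staralg_scope.
Notation "a ** b" := (amul a b)
  (at level 40, left associativity) : staralg_scope.
Notation "a ^\*" := (astar a) : staralg_scope.
Local Open Scope staralg_scope.

Record star_hom (R : realDomainType) (A B : starAlgType R) := StarHom {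
  star_hom_fun :> A -> B;
  star_hom_linear : linear star_hom_fun;
  star_homM : forall a b, star_hom_fun (a ** b) = star_hom_fun a ** star_hom_fun b;
  star_hom_star : forall a, star_hom_fun (a ^\*) = (star_hom_fun a) ^\*
}.

Section Ideals.
Variables (R : realDomainType) (A : starAlgType R).

Record star_ideal := StarIdeal {
  ideal_set :> set A;
  ideal_submodule : submodule ideal_set;
  ideal_mull : forall a x, ideal_set x -> ideal_set (a ** x);
  ideal_mulr : forall a x, ideal_set x -> ideal_set (x ** a);
  ideal_star : forall x, ideal_set x -> ideal_set (x ^\*)
}.

Lemma amulBl (a b c : A) : (a - b) ** c = a ** c - b ** c.
Proof.
by rewrite -[a - b]addrC -scaleN1r amul_linearl scaleN1r addrC.
Qed.

Lemma amulBr (a b c : A) : c ** (a - b) = c ** a - c ** b.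
Proof.
by rewrite -[a - b]addrC -scaleN1r amul_linearr scaleN1r addrC.
Qed.

Lemma cbarN1 : cbar (-1) = -1 :> cext R.
Proof. by congr Complex; rewrite !oppr0. Qed.

Lemma astarB (a b : A) : (a - b) ^\* = a ^\* - b ^\*.
Proof.
by rewrite -[a - b]addrC -scaleN1r astar_antilinear cbarN1 scaleN1r addrC.
Qed.

Variable I : star_ideal.

Definition quot_alg : Type := modquot (ideal_submodule I).
HB.instance Definition _ := GRing.Lmodule.on quot_alg.

Definition quot_proj (a : A) : quot_alg := mproj (ideal_submodule I) a.

Definition quot_mul (p q : quot_alg) : quot_alg :=
  quot_proj ((repr p : A) ** (repr q : A)).
Definition quot_star (p : quot_alg) : quot_alg := quot_proj ((repr p : A) ^\*).

Lemma quot_proj_eq a b : quot_proj a = quot_proj b <-> ideal_set I (a - b).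
Proof. exact: mproj_eq. Qed.

Lemma quot_proj_surj q : exists a, quot_proj a = q.
Proof. exact: mproj_surj. Qed.

Lemma quot_repr a : ideal_set I ((repr (quot_proj a) : A) - a).
Proof. by apply/quot_proj_eq; rewrite /quot_proj /mproj reprK. Qed.

Lemma quot_proj_linear : linear quot_proj.
Proof. exact: mproj_linear. Qed.

Lemma quot_projM a b : quot_proj (a ** b) = quot_mul (quot_proj a) (quot_proj b).
Proof.
apply/esym/quot_proj_eq.
set a' := repr _; set b' := repr _.
have -> : (a' : A) ** b' - a ** b = 1 *: ((a' - a) ** b') + a ** (b' - b).
  by rewrite scale1r amulBl amulBr addrA subrK.
apply: (proj2 (ideal_submodule I)).
  exact/ideal_mulr/quot_repr.
exact/ideal_mull/quot_repr.
Qed.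

Lemma quot_proj_star a : quot_proj (a ^\*) = quot_star (quot_proj a).
Proof.
by apply/esym/quot_proj_eq; rewrite -astarB; apply/ideal_star/quot_repr.
Qed.

Lemma quot_mulA : associative quot_mul.
Proof.
move=> p q r; have [a <-] := quot_proj_surj p.
have [b <-] := quot_proj_surj q; have [c <-] := quot_proj_surj r.
by rewrite -!quot_projM amulA.
Qed.

Lemma quot_mul_linearl r : linear (quot_mul^~ r).
Proof.
move=> z p q; have [a <-] := quot_proj_surj p.
have [b <-] := quot_proj_surj q; have [c <-] := quot_proj_surj r.
by rewrite -quot_proj_linear -!quot_projM amul_linearl quot_proj_linear.
Qed.

Lemma quot_mul_linearr r : linear (quot_mul r).
Proof.
move=> z p q; have [a <-] := quot_proj_surj p.
have [b <-] := quot_proj_surj q; have [c <-] := quot_proj_surj r.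
by rewrite -quot_proj_linear -!quot_projM amul_linearr quot_proj_linear.
Qed.

Lemma quot_star_antilinear z p q :
  quot_star (z *: p + q) = cbar z *: quot_star p + quot_star q.
Proof.
have [a <-] := quot_proj_surj p; have [b <-] := quot_proj_surj q.
by rewrite -quot_proj_linear -!quot_proj_star astar_antilinear quot_proj_linear.
Qed.

Lemma quot_starK : involutive quot_star.
Proof.
by move=> p; have [a <-] := quot_proj_surj p; rewrite -!quot_proj_star astarK.
Qed.

Lemma quot_starM p q : quot_star (quot_mul p q) = quot_mul (quot_star q) (quot_star p).
Proof.
have [a <-] := quot_proj_surj p; have [b <-] := quot_proj_surj q.
by rewrite -quot_projM -!quot_proj_star -quot_projM astarM.
Qed.

HB.instance Definition _ := isStarAlgebra.Build R quot_alg
  quot_mulA quot_mul_linearl quot_mul_linearr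
  quot_star_antilinear quot_starK quot_starM.

End Ideals.

(* [E_a E_b = E_a = E_b E_a] is required for [a < b] only, where [a < b] is    *)
(* the strict part of the preorder on the index set.                          *)
Definition has_approximate_identity (R : realDomainType) (A : starAlgType R) :=
  exists (d : Order.disp_t) (I : preorderType d) (F : I -> set A) (E : I -> A),
    (exists a : I, True) /\
    (forall a b : I, exists c : I, (a <= c)%O /\ (b <= c)%O) /\
    (forall a, submodule (F a)) /\
    (forall a b : I, (a <= b)%O -> F a `<=` F b) /\
    (forall x : A, exists a, F a x) /\
    (forall a, (E a) ^\* = E a) /\
    (forall a b : I, (a < b)%O -> E a ** E b = E a /\ E b ** E a = E a) /\
    (forall a x, F a x -> E a ** x = x /\ x ** E a = x).

HB.mixin Record isPreHilbert (R : realDomainType) H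
    of GRing.Lmodule (cext R) H := {
  hdot : H -> H -> cext R;
  hdot_linear : forall phi, scalar (hdot phi);
  hdotC : forall phi psi, hdot phi psi = cbar (hdot psi phi);
  hdot_gt0 : forall phi, phi <> 0 -> cgt0 (hdot phi phi)
}.

#[short(type="preHilbertType")]
HB.structure Definition PreHilbert (R : realDomainType) :=
  { H of GRing.Lmodule (cext R) H & isPreHilbert R H }.

Section Adjointable.
Variables (R : realDomainType) (H : preHilbertType R).

Definition is_adjoint (f g : H -> H) :=
  forall phi psi, hdot (g phi) psi = hdot phi (f psi).

Definition adjointable (f : H -> H) : Prop :=
  linear f /\ exists2 g : H -> H, linear g & is_adjoint f g.

Definition adj_pred : {pred H -> H} := fun f => `[< adjointable f >].

Lemma hdotDl (phi psi chi : H) z :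
  hdot (z *: phi + psi) chi = cbar z * hdot phi chi + hdot psi chi.
Proof.
by rewrite hdotC hdot_linear cbarD cbarM -!hdotC.
Qed.

Lemma hdot0r (phi : H) : hdot phi 0 = 0.
Proof.
have := hdot_linear phi 1 0 0; rewrite scale1r addr0 mul1r.
by move/eqP; rewrite -subr_eq0 opprD addrA subrr sub0r oppr_eq0 => /eqP.
Qed.

Lemma hdot_inj (phi psi : H) : (forall chi, hdot phi chi = hdot psi chi) -> phi = psi.
Proof.
move=> eq_hdot; apply/eqP; rewrite -subr_eq0; apply/negP => /negP/eqP.
move=> /hdot_gt0 [_]; suff -> : hdot (phi - psi) (phi - psi) = 0 by rewrite ltxx.
rewrite -[X in hdot X _]addrC -scaleN1r hdotDl cbarN1 eq_hdot.
by rewrite mulN1r addNr.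
Qed.

Lemma fctD (f g : H -> H) x : (f + g) x = f x + g x. Proof. by []. Qed.
Lemma fctZ z (f : H -> H) x : (z *: f) x = z *: f x. Proof. by []. Qed.

Lemma adj_submod_closed : subsemimod_closed adj_pred.
Proof.
have lin0 : linear (0 : H -> H).
  by move=> z u v; rewrite -[(0 : H -> H)]/(fun=> 0) /= scaler0 addr0.
split; first split.
- apply/asboolP; split=> //; exists 0 => // phi psi.
  rewrite -[(0 : H -> H)]/(fun=> 0) /= hdotC !hdot0r /cbar.
  by congr Complex; rewrite oppr0.
- move=> f g /asboolP[lf [f' lf' ff']] /asboolP[lg [g' lg' gg']].
  apply/asboolP; split.
    by move=> z u v; rewrite !fctD lf lg scalerDr addrACA.
  exists (f' + g'); first by move=> z u v; rewrite !fctD lf' lg' scalerDr addrACA.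
  move=> phi psi; rewrite !fctD -[f' phi]scale1r -[f psi]scale1r.
  by rewrite hdotDl hdot_linear cbar1 !mul1r ff' gg'.
- move=> z f /asboolP[lf [f' lf' ff']]; apply/asboolP; split.
    by move=> a u v; rewrite !fctZ lf scalerDr !scalerA (mulrC z).
  exists (cbar z *: f').
    by move=> a u v; rewrite !fctZ lf' scalerDr !scalerA (mulrC a).
  move=> phi psi; rewrite !fctZ -[_ *: f' _]addr0 -[_ *: f _]addr0.
  rewrite hdotDl hdot_linear cbarK ff' [hdot 0 _]hdotC !hdot0r /cbar.
  by congr (_ + _); congr Complex; rewrite oppr0.
Qed.

HB.instance Definition _ :=
  GRing.isSubSemiModClosed.Build (cext R) (H -> H) adj_pred adj_submod_closed.

(* The *-algebra B(H): neither boundedness nor a norm is involved.            *)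
Record bounded := Bounded { bop :> H -> H; _ : bop \in adj_pred }.
HB.instance Definition _ := [isSub for bop].
HB.instance Definition _ := [Choice of bounded by <:].
HB.instance Definition _ := [SubChoice_isSubLmodule of bounded by <:].

Lemma bop_adjointable (f : bounded) : adjointable f.
Proof. by apply/asboolP; case: f. Qed.

Lemma bop_inj (f g : bounded) : (forall phi, f phi = g phi) -> f = g.
Proof. by move=> fg; apply/val_inj/funext. Qed.

Lemma badj_ex (f : bounded) : exists g : bounded, is_adjoint f g.
Proof.
have [lf [g lg fg]] := bop_adjointable f.
suff gP : g \in adj_pred by exists (Bounded gP).
apply/asboolP; split=> //; exists (f : H -> H) => // phi psi.
by rewrite hdotC -fg -hdotC.
Qed.

Definition badj (f : bounded) : bounded := projT1 (cid (badj_ex f)).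

Lemma badjP (f : bounded) : is_adjoint f (badj f).
Proof. exact: projT2 (cid (badj_ex f)). Qed.

Lemma badj_uniq (f g : bounded) : is_adjoint f g -> badj f = g.
Proof.
move=> fg; apply: bop_inj => phi; apply: hdot_inj => psi.
by rewrite fg badjP.
Qed.

Lemma bcomp_subproof (f g : bounded) : (f : H -> H) \o g \in adj_pred.
Proof.
have [lf [f' lf' ff']] := bop_adjointable f.
have [lg [g' lg' gg']] := bop_adjointable g.
apply/asboolP; split; first by move=> z u v; rewrite /= lg lf.
exists (g' \o f'); first by move=> z u v; rewrite /= lf' lg'.
by move=> phi psi; rewrite /= gg' ff'.
Qed.

Definition bcomp (f g : bounded) : bounded := Bounded (bcomp_subproof f g).

Lemma bopD z (f g : bounded) phi : (z *: f + g : bounded) phi = z *: f phi + g phi.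
Proof. by []. Qed.

Lemma bcompA : associative bcomp.
Proof. by move=> f g h; apply: bop_inj. Qed.

Lemma bcomp_linearl h : linear (bcomp^~ h).
Proof. by move=> z f g; apply: bop_inj. Qed.

Lemma bcomp_linearr h : linear (bcomp h).
Proof.
move=> z f g; apply: bop_inj => phi.
by have [lh _] := bop_adjointable h; apply: lh.
Qed.

Lemma badj_antilinear z (f g : bounded) :
  badj (z *: f + g) = cbar z *: badj f + badj g.
Proof.
apply: badj_uniq => phi psi.
by rewrite !bopD hdotDl hdot_linear cbarK !badjP.
Qed.

Lemma badjK : involutive badj.
Proof.
by move=> f; apply: badj_uniq => phi psi; rewrite hdotC -badjP -hdotC.
Qed.

Lemma badjM (f g : bounded) : badj (bcomp f g) = bcomp (badj g) (badj f).
Proof. by apply: badj_uniq => phi psi; rewrite /= !badjP. Qed.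

HB.instance Definition _ := isStarAlgebra.Build R bounded
  bcompA bcomp_linearl bcomp_linearr badj_antilinear badjK badjM.

End Adjointable.

Record star_rep (R : realDomainType) (A : starAlgType R) := StarRep {
  rep_space : preHilbertType R;
  rep_hom :> star_hom A (bounded rep_space)
}.

Section ClosedIdeals.
Variables (R : realDomainType) (A : starAlgType R).

Definition rep_ker (rho : star_rep A) : set A := [set a | rho a = 0].

Definition closed_ideal (J : set A) : Prop :=
  exists rho : star_rep A, J = rep_ker rho.

Definition jmin_set : set A := \bigcap_(J in closed_ideal) J.

Lemma star_hom0 (B : starAlgType R) (f : star_hom A B) : f 0 = 0.
Proof.
have := star_hom_linear f 1 0 0; rewrite !scale1r addr0.
by rewrite -[LHS]addr0 => /addrI.
Qed.

Lemma amul0r (a : A) : a ** 0 = 0.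
Proof. by rewrite -(subrr a) amulBr !subrr. Qed.

Lemma amul0l (a : A) : 0 ** a = 0.
Proof. by rewrite -(subrr a) amulBl !subrr. Qed.

Lemma astar0 : (0 : A) ^\* = 0.
Proof. by rewrite -(subrr (0 : A)) astarB !subrr. Qed.

End ClosedIdeals.
Arguments jmin_set {R} A.

Section Jmin.
Variables (R : realDomainType) (A : starAlgType R).

Lemma jminP (a : A) : jmin_set A a <-> forall rho : star_rep A, rho a = 0.
Proof.
split=> [Ja rho|Ja _ [rho ->]]; last exact: Ja.
by apply: (Ja (rep_ker rho)); exists rho.
Qed.

Lemma jmin_submodule : submodule (jmin_set A).
Proof.
split; first by apply/jminP => rho; apply: star_hom0.
move=> z u v /jminP Ju /jminP Jv; apply/jminP => rho.
by rewrite star_hom_linear Ju Jv scaler0 addr0.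
Qed.

Lemma jmin_mull (a x : A) : jmin_set A x -> jmin_set A (a ** x).
Proof.
by move=> /jminP Jx; apply/jminP => rho; rewrite star_homM Jx amul0r.
Qed.

Lemma jmin_mulr (a x : A) : jmin_set A x -> jmin_set A (x ** a).
Proof.
by move=> /jminP Jx; apply/jminP => rho; rewrite star_homM Jx amul0l.
Qed.

Lemma jmin_star (x : A) : jmin_set A x -> jmin_set A (x ^\*).
Proof.
by move=> /jminP Jx; apply/jminP => rho; rewrite star_hom_star Jx astar0.
Qed.

End Jmin.

Definition jmin (R : realDomainType) (A : starAlgType R) : star_ideal A :=
  StarIdeal (jmin_submodule A) (@jmin_mull R A) (@jmin_mulr R A) (@jmin_star R A).

Section LatticeIso.
Variables (R : realDomainType).

Definition closed_ideals (A : starAlgType R) := {J : set A | closed_ideal J}.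

(* Meets and joins are given as relations on the poset of closed *-ideals.    *)
Definition is_meet (A : starAlgType R) (J K M : closed_ideals A) : Prop :=
  sval M = sval J `&` sval K.

Definition is_join (A : starAlgType R) (J K M : closed_ideals A) : Prop :=
  sval J `|` sval K `<=` sval M /\
  forall L : closed_ideals A, sval J `|` sval K `<=` sval L -> sval M `<=` sval L.

Definition isomorphic_closed_ideal_lattices (A B : starAlgType R) : Prop :=
  exists f : closed_ideals A -> closed_ideals B,
    bijective f /\
    (forall J K, sval J `<=` sval K <-> sval (f J) `<=` sval (f K)) /\
    (forall J K M, is_meet J K M <-> is_meet (f J) (f K) (f M)) /\
    (forall J K M, is_join J K M <-> is_join (f J) (f K) (f M)).

End LatticeIso.

(* All spaces of representations lie in the universe of the library's modules, *)
(* and [closed_ideal] quantifies over the same spaces as [rep_cat].           *)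

Record category := Category {
  ob : Type;
  mor : ob -> ob -> Type;
  idm : forall x, mor x x;
  cmp : forall x y z, mor y z -> mor x y -> mor x z;
  cmp1m : forall x y (f : mor x y), cmp (idm y) f = f;
  cmpm1 : forall x y (f : mor x y), cmp f (idm x) = f;
  cmpA : forall x y z t (h : mor z t) (g : mor y z) (f : mor x y),
    cmp h (cmp g f) = cmp (cmp h g) f
}.

Record functor (C D : category) := Functor {
  fob : ob C -> ob D;
  fmor : forall x y, mor x y -> mor (fob x) (fob y);
  fmor_id : forall x, fmor (idm x) = idm (fob x);
  fmor_cmp : forall x y z (g : mor y z) (f : mor x y),
    fmor (cmp g f) = cmp (fmor g) (fmor f)
}.

(* An isomorphism (not merely an equivalence) of categories is a functor       *)
(* which is bijective both on objects and on morphisms.                       *)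
Definition isomorphic_categories (C D : category) : Prop :=
  exists F : functor C D,
    bijective (fob F) /\ forall x y : ob C, bijective (@fmor C D F x y).

Section RepCategory.
Variables (R : realDomainType) (A : starAlgType R).

Definition isometric_intertwiner (rho sigma : star_rep A)
    (T : rep_space rho -> rep_space sigma) : Prop :=
  [/\ linear T,
      (forall phi psi, hdot (T phi) (T psi) = hdot phi psi) &
      (forall a phi, T (rho a phi) = sigma a (T phi))].

Definition rep_mor (rho sigma : star_rep A) :=
  {T : rep_space rho -> rep_space sigma | isometric_intertwiner T}.

Lemma rep_mor_eq rho sigma (S T : rep_mor rho sigma) : sval S = sval T -> S = T.
Proof. by case: S T => [S p] [T q] /= ST; apply: eq_exist. Qed.

Lemma rep_id_subproof (rho : star_rep A) :
  isometric_intertwiner (id : rep_space rho -> rep_space rho).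
Proof. by []. Qed.

Definition rep_id rho : rep_mor rho rho := exist _ _ (rep_id_subproof rho).

Lemma rep_cmp_subproof rho sigma tau (S : rep_mor sigma tau)
    (T : rep_mor rho sigma) : isometric_intertwiner (sval S \o sval T).
Proof.
case: S T => [S [Sl Si Sa]] [T [Tl Ti Ta]]; split=> /=.
- by move=> z u v; rewrite /= Tl Sl.
- by move=> phi psi; rewrite Si Ti.
- by move=> a phi; rewrite Ta Sa.
Qed.

Definition rep_cmp rho sigma tau (S : rep_mor sigma tau) (T : rep_mor rho sigma) :
  rep_mor rho tau := exist _ _ (rep_cmp_subproof S T).

Lemma rep_cmp1m rho sigma (T : rep_mor rho sigma) : rep_cmp (rep_id sigma) T = T.
Proof. exact: rep_mor_eq. Qed.

Lemma rep_cmpm1 rho sigma (T : rep_mor rho sigma) : rep_cmp T (rep_id rho) = T.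
Proof. exact: rep_mor_eq. Qed.

Lemma rep_cmpA rho sigma tau ups (U : rep_mor tau ups) (S : rep_mor sigma tau)
  (T : rep_mor rho sigma) : rep_cmp U (rep_cmp S T) = rep_cmp (rep_cmp U S) T.
Proof. exact: rep_mor_eq. Qed.

Definition rep_cat : category :=
  @Category (star_rep A) rep_mor rep_id rep_cmp rep_cmp1m rep_cmpm1 rep_cmpA.

Definition strongly_nondegenerate (rho : star_rep A) : Prop :=
  cspan [set psi : rep_space rho | exists a phi, psi = rho a phi] = setT.

Definition snd_rep := {rho : star_rep A | strongly_nondegenerate rho}.

Definition snd_rep_cat : category :=
  @Category snd_rep (fun rho sigma => rep_mor (sval rho) (sval sigma))
    (fun rho => rep_id (sval rho))
    (fun _ _ _ S T => rep_cmp S T)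
    (fun _ _ T => rep_cmp1m T)
    (fun _ _ T => rep_cmpm1 T)
    (fun _ _ _ _ U S T => rep_cmpA U S T).

End RepCategory.

Record bimodule (R : realDomainType) (B A : starAlgType R) := Bimodule {
  bim :> lmodType (cext R);
  lact : B -> bim -> bim;
  ract : bim -> A -> bim;
  lact_linearl : forall x, linear (lact^~ x);
  lact_linearr : forall b, linear (lact b);
  lactA : forall b c x, lact (b ** c) x = lact b (lact c x);
  ract_linearl : forall a, linear (ract^~ a);
  ract_linearr : forall x, linear (ract x);
  ractA : forall x a c, ract x (a ** c) = ract (ract x a) c;
  lractA : forall b x a, lact b (ract x a) = ract (lact b x) a
}.
Notation "b @> x" := (lact b x) (at level 40, left associativity) : staralg_scope.
Notation "x <@ a" := (ract x a) (at level 40, left associativity) : staralg_scope.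

(* The conjugate module: same additive group, scalars act through [cbar]. *)
Definition conj_mod (R : realDomainType) (V : lmodType (cext R)) : Type := V.

Section ConjugateModule.
Variables (R : realDomainType) (V : lmodType (cext R)).

HB.instance Definition _ := GRing.Zmodule.copy (conj_mod V) V.

Definition conj_scale (z : cext R) (x : conj_mod V) : conj_mod V :=
  cbar z *: (x : V).

Lemma conj_scaleA a b x : conj_scale a (conj_scale b x) = conj_scale (a * b) x.
Proof. by rewrite /conj_scale scalerA cbarM. Qed.

Lemma conj_scale1 : left_id 1 conj_scale.
Proof. by move=> x; rewrite /conj_scale cbar1 scale1r. Qed.

Lemma conj_scaleDr : right_distributive conj_scale +%R.
Proof. by move=> a x y; apply: scalerDr. Qed.

Lemma conj_scaleDl x : {morph conj_scale^~ x : a b / a + b}.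
Proof. by move=> a b; rewrite /conj_scale cbarD scalerDl. Qed.

HB.instance Definition _ := GRing.Zmodule_isLmodule.Build (cext R) (conj_mod V)
  conj_scaleA conj_scale1 conj_scaleDr conj_scaleDl.

End ConjugateModule.

Section ConjugateBimodule.
Variables (R : realDomainType) (B A : starAlgType R) (X : bimodule B A).

Definition conj_lact (a : A) (x : conj_mod X) : conj_mod X := (x : X) <@ a ^\*.
Definition conj_ract (x : conj_mod X) (b : B) : conj_mod X := b ^\* @> (x : X).

Lemma conj_lact_linearl x : linear (conj_lact^~ x).
Proof. by move=> z a b; rewrite /conj_lact astar_antilinear ract_linearr. Qed.

Lemma conj_lact_linearr a : linear (conj_lact a).
Proof. by move=> z x y; apply: ract_linearl. Qed.

Lemma conj_lactA a c x : conj_lact (a ** c) x = conj_lact a (conj_lact c x).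
Proof. by rewrite /conj_lact astarM ractA. Qed.

Lemma conj_ract_linearl b : linear (conj_ract^~ b).
Proof. by move=> z x y; apply: lact_linearr. Qed.

Lemma conj_ract_linearr x : linear (conj_ract x).
Proof. by move=> z a b; rewrite /conj_ract astar_antilinear lact_linearl. Qed.

Lemma conj_ractA x b c : conj_ract x (b ** c) = conj_ract (conj_ract x b) c.
Proof. by rewrite /conj_ract astarM lactA. Qed.

Lemma conj_lractA a x b : conj_lact a (conj_ract x b) = conj_ract (conj_lact a x) b.
Proof. by rewrite /conj_lact /conj_ract lractA. Qed.

Definition conj_bimodule : bimodule A B :=
  @Bimodule R A B (conj_mod X) conj_lact conj_ract
    conj_lact_linearl conj_lact_linearr conj_lactA
    conj_ract_linearl conj_ract_linearr conj_ractA conj_lractA.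

End ConjugateBimodule.

Section Tensor.
Variables (R : realDomainType) (B A : starAlgType R).
Variables (X : bimodule B A) (rho : star_rep A).
Local Notation H := (rep_space rho).

Definition tfree : Type := {freeg (X * H)%type / cext R}.
HB.instance Definition _ := GRing.Lmodule.on tfree.

Definition tgen (x : X) (psi : H) : tfree := << (x, psi) >>.

Definition tensor_rel : set tfree :=
  [set t | (exists x y psi, t = tgen (x + y) psi - tgen x psi - tgen y psi) \/
           (exists x phi psi, t = tgen x (phi + psi) - tgen x phi - tgen x psi) \/
           (exists z x psi, t = tgen (z *: x) psi - z *: tgen x psi) \/
           (exists z x psi, t = tgen x (z *: psi) - z *: tgen x psi) \/
           (exists x a psi, t = tgen (x <@ a) psi - tgen x (rho a psi))].

(* The tensor product X (x)_A H as the free C-module on X * H modulo the       *)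
(* C-bilinearity and A-balancing relations.                                   *)
Definition tensor : lmodType (cext R) := modquot (cspan_submodule tensor_rel).

Definition tens (x : X) (psi : H) : tensor :=
  mproj (cspan_submodule tensor_rel) (tgen x psi).

End Tensor.

Section Morita.
Variable R : realDomainType.

Definition positive_functional (A : starAlgType R) (omega : A -> cext R) : Prop :=
  scalar omega /\ forall a, cge0 (omega (a ^\* ** a)).

Definition positive_element (A : starAlgType R) (a : A) : Prop :=
  a ^\* = a /\ forall omega, positive_functional omega -> cge0 (omega a).

Section InnerProducts.
Variables (B A : starAlgType R) (X : bimodule B A).

Definition right_inner_product (f : X -> X -> A) : Prop :=
  [/\ (forall x, linear (f x)),
      (forall x y a, f x (y <@ a) = f x y ** a) &
      (forall x y, f x y = (f y x) ^\*)].

Definition left_inner_product (g : X -> X -> B) : Prop :=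
  [/\ (forall y, linear (g^~ y)),
      (forall b x y, g (b @> x) y = b ** g x y) &
      (forall x y, g x y = (g y x) ^\*)].

Definition psd_inner_product (D : starAlgType R) (f : X -> X -> D) : Prop :=
  forall x, positive_element (f x x).

Definition full_inner_product (D : starAlgType R) (f : X -> X -> D) : Prop :=
  cspan [set d | exists x y, d = f x y] = setT.

(* The Hermitian product [h] is unique, as the elementary tensors span. *)
Definition property_P (f : X -> X -> A) : Prop :=
  forall rho : star_rep A,
    exists h : tensor X rho -> tensor X rho -> cext R,
      [/\ (forall s, scalar (h s)),
          (forall s t, h s t = cbar (h t s)),
          (forall x psi y phi,
             h (tens x psi) (tens y phi) = hdot psi (rho (f x y) phi)) &
          (forall t, cge0 (h t t))].

End InnerProducts.

Definition property_Q (B A : starAlgType R) (X : bimodule B A)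
    (g : X -> X -> B) : Prop :=
  @property_P A B (conj_bimodule X) g.

Definition formally_morita_equivalent (A B : starAlgType R) : Prop :=
  exists (X : bimodule B A) (f : X -> X -> A) (g : X -> X -> B),
    (right_inner_product f /\ psd_inner_product f /\ full_inner_product f) /\
    (left_inner_product g /\ psd_inner_product g /\ full_inner_product g) /\
    (forall b x y, f (b @> x) y = f x (b ^\* @> y)) /\
    (forall x a y, g (x <@ a) y = g x (y <@ a ^\*)) /\
    (forall x y z, x <@ f y z = g x y @> z) /\
    property_P f /\
    property_Q g.

End Morita.

(* Main.v *)
Require Import Defs.
From HB Require Import structures.
From mathcomp Require Import all_boot all_order all_algebra.
From mathcomp Require Import generic_quotient boolp classical_sets.
From mathcomp Require Import complex freeg.
From mathcomp Require Import ring.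

(* A *-ideal I inside J_min(A) is killed by every *-representation of A, so   *)
(* the *-representations of A/I are those of A, on the same spaces with the   *)
(* same intertwiners; the kernels correspond through the quotient maps.       *)
(* On the other hand, the triviality of J_min is a Morita invariant when      *)
(* there is an approximate identity.  Let X be an equivalence (B-D)-bimodule  *)
(* with J_min(B) = 0, and let d lie in J_min(D).  Each representation of B    *)
(* induces, through the conjugate of X and property Q, one of D, where d acts *)
(* by zero; so the B-valued inner product <x.d, y> lies in J_min(B) = 0.      *)
(* Since x.d<y, z> = <x.d, y>.z, fullness gives x.d = 0 for all x, then d = 0. *)
(* Finally J_min(A/I) = J_min(A)/I is nonzero, while J_min(A/J_min(A)) = 0.   *)

Set Implicit Arguments.
Unset Strict Implicit.
Unset Printing Implicit Defensive.

Import Order.TTheory GRing.Theory Num.Theory.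

Local Open Scope classical_set_scope.
Local Open Scope ring_scope.
Local Open Scope staralg_scope.

(** All three isomorphisms come from [rep_transfer], defined for any two *-ideals inside J_min(A);
    exchanging the ideals gives the inverse. The failure of Morita equivalence rests on
    [rieffel_induction]: the form given by property P is pulled back to a free module and its null
    vectors are divided out, where [isotropic_null] replaces the Cauchy-Schwarz inequality because
    scalars cannot be inverted. [morita_jmin0] and [quot_jmin] then separate the two quotients. *)

Lemma linear_fun0 (R : realDomainType) (U V : lmodType (cext R)) (F : U -> V) :
  linear F -> F 0 = 0.
Proof. by move=> /(_ (-1) 0 0); rewrite scaler0 addr0 scaleN1r addNr. Qed.

Lemma star_hom_eq (R : realDomainType) (A B : starAlgType R) (f g : star_hom A B) :
  f =1 g -> f = g.
Proof.
case: f g => [f fl fM fs] [g gl gM gs] /= /funext fg.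
by subst g; congr StarHom; apply: Prop_irrelevance.
Qed.

(** * Representations of quotients *)

Section QuotientRepresentations.
Variables (R : realDomainType) (A : starAlgType R).

Section Descent.
Variables (I : star_ideal A) (I_sub : ideal_set I `<=` jmin_set A).
Variable (rho : star_rep A).

Definition descent_fun (p : quot_alg I) : bounded (rep_space rho) :=
  rho (repr p : A).

(** Every *-representation of A kills J_min(A), hence I, so the choice of representative in
    [descent_fun] is immaterial. *)
Lemma descent_proj a : descent_fun (quot_proj I a) = rho a.
Proof.
have /I_sub/jminP/(_ rho) := @quot_repr _ _ I a.
rewrite addrC -scaleN1r star_hom_linear scaleN1r addrC => /eqP.
by rewrite subr_eq0 => /eqP.
Qed.

Lemma descent_linear : linear descent_fun.
Proof.
move=> z p q; have [a <-] := quot_proj_surj p; have [b <-] := quot_proj_surj q.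
by rewrite -quot_proj_linear !descent_proj star_hom_linear.
Qed.

Lemma descentM p q : descent_fun (p ** q) = descent_fun p ** descent_fun q.
Proof.
have [a <-] := quot_proj_surj p; have [b <-] := quot_proj_surj q.
by rewrite -[LHS]/(descent_fun (quot_mul _ _)) -quot_projM !descent_proj star_homM.
Qed.

Lemma descent_star p : descent_fun (p ^\*) = (descent_fun p) ^\*.
Proof.
have [a <-] := quot_proj_surj p.
by rewrite -[LHS]/(descent_fun (quot_star _)) -quot_proj_star !descent_proj star_hom_star.
Qed.

Definition rep_descent : star_rep (quot_alg I) :=
  StarRep (StarHom descent_linear descentM descent_star).

End Descent.

Section Pullback.
Variables (I : star_ideal A) (rho : star_rep (quot_alg I)).

Definition pullback_fun (a : A) : bounded (rep_space rho) := rho (quot_proj I a).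

Lemma pullback_linear : linear pullback_fun.
Proof. by move=> z a b; rewrite /pullback_fun quot_proj_linear star_hom_linear. Qed.

Lemma pullbackM a b : pullback_fun (a ** b) = pullback_fun a ** pullback_fun b.
Proof. by rewrite /pullback_fun quot_projM star_homM. Qed.

Lemma pullback_star a : pullback_fun (a ^\*) = (pullback_fun a) ^\*.
Proof. by rewrite /pullback_fun quot_proj_star star_hom_star. Qed.

Definition rep_pullback : star_rep A :=
  StarRep (StarHom pullback_linear pullbackM pullback_star).

End Pullback.

Section Transfer.
Variables (I K : star_ideal A) (K_sub : ideal_set K `<=` jmin_set A).

(** The route through A keeps the space and the operators, so intertwiners can be carried over as
    the same functions. *)
Definition rep_transfer (rho : star_rep (quot_alg I)) : star_rep (quot_alg K) :=
  rep_descent K_sub (rep_pullback rho).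

Lemma rep_transferE rho a :
  rep_transfer rho (quot_proj K a) = rho (quot_proj I a).
Proof. exact: (descent_proj K_sub (rep_pullback rho)). Qed.

Lemma transfer_intertwiner (rho sigma : star_rep (quot_alg I))
    (T : rep_space rho -> rep_space sigma) :
  @isometric_intertwiner _ _ rho sigma T <->
  @isometric_intertwiner _ _ (rep_transfer rho) (rep_transfer sigma) T.
Proof.
split=> -[Tl Ti Ta]; split=> // p phi; have [a <-] := quot_proj_surj p.
  by rewrite !rep_transferE Ta.
by have := Ta (quot_proj K a) phi; rewrite !rep_transferE.
Qed.

Definition mor_transfer (rho sigma : star_rep (quot_alg I)) (T : rep_mor rho sigma) :
    rep_mor (rep_transfer rho) (rep_transfer sigma) :=
  exist _ (sval T) (proj1 (transfer_intertwiner _) (svalP T)).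

Lemma mor_transfer_bij rho sigma : bijective (@mor_transfer rho sigma).
Proof.
exists (fun T : rep_mor (rep_transfer rho) (rep_transfer sigma) =>
  exist _ (sval T) (proj2 (transfer_intertwiner _) (svalP T)) : rep_mor rho sigma);
  by move=> T; apply: rep_mor_eq.
Qed.

(** Closed by [Defined], since [rep_cat_iso] has to see the maps on objects and morphisms. *)
Definition rep_transfer_functor : functor (rep_cat (quot_alg I)) (rep_cat (quot_alg K)).
Proof.
exists rep_transfer mor_transfer => *; exact: rep_mor_eq.
Defined.

Lemma transfer_nondegenerate rho :
  strongly_nondegenerate rho -> strongly_nondegenerate (rep_transfer rho).
Proof.
rewrite /strongly_nondegenerate => <-; congr cspan.
apply/seteqP; split=> psi [p [phi ->]].
  have [a <-] := quot_proj_surj p.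
  by exists (quot_proj I a), phi; rewrite rep_transferE.
have [a <-] := quot_proj_surj p.
by exists (quot_proj K a), phi; rewrite rep_transferE.
Qed.

Definition snd_transfer (rho : snd_rep (quot_alg I)) : snd_rep (quot_alg K) :=
  exist _ (rep_transfer (sval rho)) (transfer_nondegenerate (svalP rho)).

Definition snd_transfer_functor :
  functor (snd_rep_cat (quot_alg I)) (snd_rep_cat (quot_alg K)).
Proof.
exists snd_transfer (fun rho sigma T => @mor_transfer (sval rho) (sval sigma) T) => *;
  exact: rep_mor_eq.
Defined.

(** The image in A/K of the preimage of [S] in A. *)
Definition set_transfer (S : set (quot_alg I)) : set (quot_alg K) :=
  [set p | exists2 a, p = quot_proj K a & S (quot_proj I a)].

Lemma set_transfer_ker rho : set_transfer (rep_ker rho) = rep_ker (rep_transfer rho).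
Proof.
apply/seteqP; split=> [p [a -> ra0]|p].
  by rewrite /rep_ker/mkset rep_transferE.
have [a <-] := quot_proj_surj p; rewrite /rep_ker/mkset rep_transferE => ra0.
by exists a.
Qed.

End Transfer.

Section TransferIso.
Variables (I K : star_ideal A).
Hypotheses (I_sub : ideal_set I `<=` jmin_set A) (K_sub : ideal_set K `<=` jmin_set A).

Lemma rep_transferK : cancel (@rep_transfer I K K_sub) (@rep_transfer K I I_sub).
Proof.
(* With the record expanded, both sides have the same space and only the homomorphisms are left to
   compare. *)
move=> rho; transitivity (StarRep (rep_hom rho)); last by case: rho.
apply: (congr1 (@StarRep _ _ (rep_space rho))); apply: star_hom_eq => p.
have [a <-] := quot_proj_surj p.
rewrite -[LHS]/(rep_transfer I_sub (rep_transfer K_sub rho) (quot_proj I a)).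
by rewrite 2!rep_transferE.
Qed.

(** Closedness matters from left to right: another representative of the class modulo K differs from
    [a] by an element of J_min(A), which a kernel cannot detect. *)
Lemma set_transferE (S : set (quot_alg I)) a :
  closed_ideal S -> @set_transfer I K S (quot_proj K a) <-> S (quot_proj I a).
Proof.
move=> [rho ->]; rewrite (set_transfer_ker K_sub).
by rewrite /rep_ker/mkset rep_transferE.
Qed.

Lemma set_transfer_closed (S : set (quot_alg I)) :
  closed_ideal S -> closed_ideal (@set_transfer I K S).
Proof. by move=> [rho ->]; exists (rep_transfer K_sub rho); apply: set_transfer_ker. Qed.

Definition ideal_transfer (S : closed_ideals (quot_alg I)) : closed_ideals (quot_alg K) :=
  exist _ _ (set_transfer_closed (svalP S)).

Lemma ideal_transferE S a :
  sval (ideal_transfer S) (quot_proj K a) <-> sval S (quot_proj I a).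
Proof. exact: set_transferE (svalP S). Qed.

Lemma ideal_transfer_sub (S T : closed_ideals (quot_alg I)) :
  sval S `<=` sval T <-> sval (ideal_transfer S) `<=` sval (ideal_transfer T).
Proof.
split=> ST p; have [a <-] := quot_proj_surj p.
  by move=> /ideal_transferE/ST/ideal_transferE.
by move=> /ideal_transferE/ST/ideal_transferE.
Qed.

Lemma ideal_transfer_meet S T M :
  is_meet S T M <-> is_meet (ideal_transfer S) (ideal_transfer T) (ideal_transfer M).
Proof.
rewrite /is_meet; split=> STM; apply/seteqP; split=> p; have [a <-] := quot_proj_surj p.
- by move=> /ideal_transferE; rewrite STM => -[? ?]; split; apply/ideal_transferE.
- by move=> [/ideal_transferE ? /ideal_transferE ?]; apply/ideal_transferE; rewrite STM.
- by move=> /ideal_transferE; rewrite STM => -[/ideal_transferE ? /ideal_transferE ?].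
- by move=> [? ?]; apply/ideal_transferE; rewrite STM; split; apply/ideal_transferE.
Qed.

End TransferIso.

Section Isomorphisms.
Variables (I K : star_ideal A).
Hypotheses (I_sub : ideal_set I `<=` jmin_set A) (K_sub : ideal_set K `<=` jmin_set A).

Lemma rep_cat_iso : isomorphic_categories (rep_cat (quot_alg I)) (rep_cat (quot_alg K)).
Proof.
exists (rep_transfer_functor I K_sub); split; last exact: mor_transfer_bij.
by exists (rep_transfer I_sub); apply: rep_transferK.
Qed.

Lemma snd_rep_cat_iso :
  isomorphic_categories (snd_rep_cat (quot_alg I)) (snd_rep_cat (quot_alg K)).
Proof.
exists (snd_transfer_functor I K_sub); split=> [|rho sigma]; last exact: mor_transfer_bij.
by exists (snd_transfer I_sub) => -[rho ?]; apply: eq_exist; apply: rep_transferK.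
Qed.

Lemma ideal_transferK : cancel (@ideal_transfer I K K_sub) (@ideal_transfer K I I_sub).
Proof.
move=> S; apply: eq_sig_hprop => [T|]; first exact: Prop_irrelevance.
apply/seteqP; split=> p; have [a <-] := quot_proj_surj p.
  by move=> /ideal_transferE/ideal_transferE.
by move=> Sa; apply/ideal_transferE/ideal_transferE.
Qed.

End Isomorphisms.

Lemma closed_ideal_lattice_iso (I K : star_ideal A) :
  ideal_set I `<=` jmin_set A -> ideal_set K `<=` jmin_set A ->
  isomorphic_closed_ideal_lattices (quot_alg I) (quot_alg K).
Proof.
move=> I_sub K_sub; exists (@ideal_transfer I K K_sub).
have subE := @ideal_transfer_sub I K K_sub.
split; [|split; [exact: subE|split; [exact: ideal_transfer_meet|]]].
  by exists (ideal_transfer I_sub); apply: ideal_transferK.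
move=> S T M; rewrite /is_join !subUset.
split=> -[[/subE SM /subE TM] minM]; split=> // L.
  (* Every upper bound in the target is itself a transfer, so minimality in the source applies to
     it. *)
  rewrite -[L](ideal_transferK K_sub I_sub) !subUset.
  by move=> [/subE SL /subE TL]; apply/subE/minM; rewrite subUset.
rewrite subUset => -[/subE SL /subE TL].
by apply/subE/minM; rewrite subUset.
Qed.

End QuotientRepresentations.

(** * Representations from positive semi-definite forms *)

Record psd_form (R : realDomainType) (V : lmodType (cext R)) := PsdForm {
  form :> V -> V -> cext R;
  form_linear : forall t, scalar (form t);
  formC : forall s t, form s t = cbar (form t s);
  form_ge0 : forall t, cge0 (form t t)
}.

Section PsdForm.
Variables (R : realDomainType) (V : lmodType (cext R)) (h : psd_form V).

Lemma cbarE (a b : R) : cbar (Complex a b) = Complex a (- b).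
Proof. by []. Qed.

Lemma cextM (a b c d : R) :
  (Complex a b : cext R) * Complex c d = Complex (a * c - b * d) (a * d + b * c).
Proof. by []. Qed.

Lemma cextD (a b c d : R) :
  (Complex a b : cext R) + Complex c d = Complex (a + c) (b + d).
Proof. by []. Qed.

Lemma form_linearl z s t u : h (z *: s + t) u = cbar z * h s u + h t u.
Proof. by rewrite formC form_linear cbarD cbarM -!formC. Qed.

Lemma form0r t : h t 0 = 0.
Proof.
have := form_linear h t 1 0 0; rewrite scale1r addr0 mul1r => /eqP.
by rewrite -subr_eq0 opprD addrA subrr sub0r oppr_eq0 => /eqP.
Qed.

Lemma formZr z s t : h s (z *: t) = z * h s t.
Proof. by rewrite -[z *: t]addr0 form_linear form0r addr0. Qed.

Lemma formBr s t u : h s (t - u) = h s t - h s u.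
Proof. by rewrite addrC -scaleN1r form_linear mulN1r addrC. Qed.

Lemma form_sumr I (r : seq I) z (u : I -> V) s :
  h s (\sum_(i <- r) z i *: u i) = \sum_(i <- r) z i * h s (u i).
Proof.
elim: r => [|i r IHr]; first by rewrite !big_nil form0r.
by rewrite !big_cons form_linear IHr.
Qed.

Lemma form_suml I (r : seq I) z (u : I -> V) s :
  h (\sum_(i <- r) z i *: u i) s = \sum_(i <- r) cbar (z i) * h (u i) s.
Proof.
elim: r => [|i r IHr]; last by rewrite !big_cons form_linearl IHr.
by rewrite !big_nil formC form0r cbarE oppr0.
Qed.

Lemma form_expand z w s t :
  h (z *: s + w *: t) (z *: s + w *: t) =
  cbar z * (z * h s s + w * h s t) + cbar w * (z * h t s + w * h t t).
Proof.
by rewrite form_linearl [h (w *: t) _]formC formZr cbarM -formC !form_linear !formZr.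
Qed.

(* Over an ordered ring one cannot divide by [h t t]; the vector              *)
(* [- (b + 1) c s + |c|^2 t], where [c = h s t] and [b = h t t], is used      *)
(* instead: its square norm is [- (b + 2) |c|^4].                             *)
Lemma isotropic_null s t : h s s = 0 -> h s t = 0.
Proof.
move=> hss; case: (form_ge0 h t); case E: (h t t) => [b b'] /= b'0 b_ge0.
rewrite {b'}b'0 in E.
case Est: (h s t) => [x y]; have Ets : h t s = Complex x (- y) by rewrite formC Est.
set n := x ^+ 2 + y ^+ 2.
have [_] := form_ge0 h ((Complex (- (b + 1) * x) (- (b + 1) * y) : cext R) *: s +
  (Complex n 0 : cext R) *: t).
rewrite form_expand hss Est Ets E mulr0 add0r.
set w := complex.Re _.
have -> : w = - (b + 2) * n ^+ 2.
  by rewrite /w !(cbarE, cextM, cextD) /n; cbn [complex.Re]; ring.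
have n_ge0 : 0 <= n by rewrite addr_ge0 ?sqr_ge0.
rewrite mulNr oppr_ge0 pmulr_rle0 ?ltr_wpDl // => n2_le0.
have /eqP : n = 0.
  by apply/eqP; rewrite -sqrf_eq0 eq_le n2_le0 sqr_ge0.
rewrite paddr_eq0 ?sqr_ge0 // !sqrf_eq0 => /andP[/eqP-> /eqP->].
by [].
Qed.

(** The radical of [h], which is visibly a submodule; by [isotropic_null] it is also the set of
    isotropic vectors. *)
Definition null_set : set V := [set t | forall s, h s t = 0].

Lemma null_submodule : submodule null_set.
Proof.
split=> [s|z u v Nu Nv s]; first exact: form0r.
by rewrite form_linear Nu Nv mulr0 addr0.
Qed.

Definition gns_space : Type := modquot null_submodule.
HB.instance Definition _ := GRing.Lmodule.on gns_space.

Definition gns_proj (t : V) : gns_space := mproj null_submodule t.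

Lemma gns_projP s t : gns_proj s = gns_proj t <-> forall u, h u s = h u t.
Proof.
rewrite /gns_proj mproj_eq; split=> st u; last by rewrite formBr st subrr.
by apply/eqP; rewrite -subr_eq0 -formBr st.
Qed.

Lemma gns_proj_surj q : exists t, gns_proj t = q.
Proof. exact: mproj_surj. Qed.

Lemma gns_proj_linear : linear gns_proj.
Proof. exact: mproj_linear. Qed.

Lemma form_repr s t : h s (repr (gns_proj t) : V) = h s t.
Proof. by move: s; apply/gns_projP; rewrite /gns_proj /mproj reprK. Qed.

Definition gns_dot (p q : gns_space) : cext R := h (repr p) (repr q).

Lemma gns_dotE s t : gns_dot (gns_proj s) (gns_proj t) = h s t.
Proof.
by rewrite /gns_dot form_repr formC form_repr -formC.
Qed.

Lemma gns_dot_linear p : scalar (gns_dot p).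
Proof.
move=> z q r; have [s <-] := gns_proj_surj p.
have [t <-] := gns_proj_surj q; have [u <-] := gns_proj_surj r.
by rewrite -gns_proj_linear !gns_dotE form_linear.
Qed.

Lemma gns_dotC p q : gns_dot p q = cbar (gns_dot q p).
Proof. exact: formC. Qed.

Lemma gns_dot_gt0 p : p <> 0 -> cgt0 (gns_dot p p).
Proof.
have [t <-] := gns_proj_surj p; rewrite gns_dotE => t_neq0.
have [im0 re_ge0] := form_ge0 h t; split=> //; rewrite lt_neqAle re_ge0 andbT.
apply/eqP => re0; apply: t_neq0; transitivity (gns_proj 0).
  apply/gns_projP => u; rewrite form0r formC isotropic_null.
    by rewrite cbarE oppr0.
  by case: (h t t) im0 re0 => a b /= -> <-.
exact: linear_fun0 gns_proj_linear.
Qed.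

HB.instance Definition _ := isPreHilbert.Build R gns_space
  gns_dot_linear gns_dotC gns_dot_gt0.

Section Action.
Variables (D : starAlgType R) (act : D -> V -> V).
(** The laws are asked only inside the form, that is, modulo null vectors. Linearity in the vector
    follows from adjointness. *)
Hypotheses
  (act_adj : forall a s t, h (act a s) t = h s (act (a ^\*) t))
  (act_linear : forall z a b s t,
     h s (act (z *: a + b) t) = z * h s (act a t) + h s (act b t))
  (actM : forall a b s t, h s (act (a ** b) t) = h s (act a (act b t))).

Lemma act_adjr a s t : h s (act a t) = h (act (a ^\*) s) t.
Proof. by rewrite act_adj astarK. Qed.

Definition gns_act (a : D) (q : gns_space) : gns_space := gns_proj (act a (repr q)).

(** Once moved to the other argument by adjointness, the action cannot distinguish vectors that
    differ by a null vector. *)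
Lemma gns_actE a t : gns_act a (gns_proj t) = gns_proj (act a t).
Proof.
by apply/gns_projP => u; rewrite !act_adjr form_repr.
Qed.

Lemma gns_act_linear a : linear (gns_act a).
Proof.
move=> z p q; have [s <-] := gns_proj_surj p; have [t <-] := gns_proj_surj q.
rewrite -gns_proj_linear !gns_actE -gns_proj_linear; apply/gns_projP => u.
by rewrite act_adjr !form_linear -!act_adjr.
Qed.

Lemma gns_act_adjoint a : is_adjoint (gns_act a) (gns_act (a ^\*)).
Proof.
move=> p q; have [s <-] := gns_proj_surj p; have [t <-] := gns_proj_surj q.
by rewrite !gns_actE -![hdot _ _]/(gns_dot _ _) !gns_dotE act_adjr.
Qed.

Lemma gns_act_adjointable a : gns_act a \in @adj_pred R gns_space.
Proof.
apply/asboolP; split; first exact: gns_act_linear.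
exists (gns_act (a ^\*)); [exact: gns_act_linear|exact: gns_act_adjoint].
Qed.

Definition gns_op a : bounded gns_space := Bounded (gns_act_adjointable a).

Lemma gns_op_linear : linear gns_op.
Proof.
move=> z a b; apply: bop_inj => q; have [t <-] := gns_proj_surj q.
rewrite bopD /= !gns_actE -gns_proj_linear; apply/gns_projP => u.
by rewrite act_linear form_linear.
Qed.

Lemma gns_opM a b : gns_op (a ** b) = gns_op a ** gns_op b.
Proof.
apply: bop_inj => q; have [t <-] := gns_proj_surj q.
by rewrite /= !gns_actE; apply/gns_projP => u; apply: actM.
Qed.

Lemma gns_op_star a : gns_op (a ^\*) = (gns_op a) ^\*.
Proof. by apply/esym/badj_uniq/gns_act_adjoint. Qed.

Definition gns_rep : star_rep D := StarRep (StarHom gns_op_linear gns_opM gns_op_star).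

Lemma gns_rep_eq0 a : gns_rep a = 0 -> forall s t, h s (act a t) = 0.
Proof.
move=> a0 s t; rewrite -gns_dotE -gns_actE.
have -> : gns_act a (gns_proj t) = 0.
  by rewrite -[LHS]/((gns_rep a : bounded _) (gns_proj t)) a0.
exact: (hdot0r (gns_proj s)).
Qed.

End Action.

End PsdForm.

(** * Morita invariance of the triviality of J_min *)

Section RieffelInduction.
Variables (R : realDomainType) (B A : starAlgType R) (X : bimodule B A).
Variables (f : X -> X -> A) (rho : star_rep A).
Hypotheses (f_linear : forall x, linear (f x))
           (f_adj : forall b x y, f (b @> x) y = f x (b ^\* @> y))
           (f_P : property_P f).
Local Notation V := (tfree X rho).

(** The lift of [phi] tensored with the identity to the free module; no operator on [tensor X rho]
    has to be shown well defined. *)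
Definition tfree_map (phi : X -> X) (t : V) : V :=
  \sum_(z <- dom t) coeff z t *: tgen (rho := rho) (phi z.1) z.2.

Lemma tfree_map_id t : tfree_map id t = t.
Proof.
rewrite -[RHS]freeg_sumE; apply: eq_bigr => -[x psi] _.
by apply/eqP/freeg_eqP => w; rewrite coeffZ !coeffU mul1r.
Qed.

Lemma tfree_map_gen phi x psi : tfree_map phi (tgen x psi) = tgen (phi x) psi.
Proof. by rewrite /tfree_map domU1 big_seq1 coeffU eqxx mulr1 scale1r. Qed.

(** The form of property P is pulled back along the projection; the tensor relations thereby become
    null vectors. *)
Lemma tensor_form_ex : exists h : psd_form V, forall x psi y phi,
  h (tgen x psi) (tgen y phi) = hdot psi (rho (f x y) phi).
Proof.
have [h [h_lin hC hE h_ge0]] := f_P rho.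
pose p : V -> tensor X rho := mproj (cspan_submodule (@tensor_rel _ _ _ X rho)).
have lin t : scalar (fun s => h (p t) (p s)).
  by move=> z s u; rewrite /p mproj_linear h_lin.
by exists (PsdForm lin (fun s t => hC (p s) (p t)) (fun t => h_ge0 (p t))).
Qed.

(** [sigma] acts on classes of x (x) phi through the left action on x. If [b] acts by zero, the
    matrix coefficients of [rho (f x (b @> y))] all vanish, being products of x (x) psi with by (x)
    phi. *)
Lemma rieffel_induction : exists sigma : star_rep B,
  forall b, sigma b = 0 -> forall x y, rho (f x (b @> y)) = 0.
Proof.
have [h hE] := tensor_form_ex.
(* Maps are allowed on both sides so that, with [id] on one of them, the laws of [act] reduce to
   termwise identities for [f]. *)
have mapE phi psi s t : h (tfree_map phi s) (tfree_map psi t) =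
    \sum_(z <- dom s) cbar (coeff z s) * \sum_(w <- dom t) coeff w t *
      hdot z.2 (rho (f (phi z.1) (psi w.1)) w.2).
  rewrite form_suml; apply: eq_bigr => z _; rewrite form_sumr; congr (_ * _).
  by apply: eq_bigr => w _; rewrite hE.
pose act b := tfree_map (lact b).
have act_adj b s t : h (act b s) t = h s (act (b ^\*) t).
  rewrite -[t in LHS]tfree_map_id -[s in RHS]tfree_map_id !mapE.
  by under eq_bigr do under eq_bigr do rewrite f_adj.
have act_linear z b c s t :
    h s (act (z *: b + c) t) = z * h s (act b t) + h s (act c t).
  rewrite -[s]tfree_map_id !mapE [z * _]mulr_sumr -big_split; apply: eq_bigr => v _ /=.
  rewrite [z * _]mulrCA -mulrDr [z * _]mulr_sumr -big_split.
  congr (_ * _); apply: eq_bigr => w _ /=.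
  rewrite lact_linearl f_linear star_hom_linear bopD hdot_linear.
  by rewrite mulrDr mulrCA.
have actM b c s t : h s (act (b ** c) t) = h s (act b (act c t)).
  (* Moving [b] to the left argument avoids expanding over the support of [act c t]. *)
  rewrite -[b in RHS]astarK -act_adj -[s in LHS]tfree_map_id !mapE.
  by under [RHS]eq_bigr do under eq_bigr do rewrite f_adj astarK -lactA.
exists (gns_rep act_adj act_linear actM) => b /gns_rep_eq0 b0 x y.
apply: bop_inj => phi; apply: hdot_inj => psi.
rewrite hdotC [RHS]hdotC -[bop 0 phi]/(0 : rep_space rho) hdot0r.
by have := b0 (tgen x psi) (tgen y phi); rewrite /act tfree_map_gen hE => ->.
Qed.

End RieffelInduction.

Section MoritaInvariance.
Variables (R : realDomainType) (A B : starAlgType R).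

Lemma span_mul0 (V : lmodType (cext R)) (S : set A) (F : A -> V) :
  linear F -> cspan S = setT -> (forall a, S a -> F a = 0) -> forall a, F a = 0.
Proof.
move=> F_lin S_full F0 a; have : cspan S a by rewrite S_full.
move=> [n [z [s [Ss ->]]]].
elim: n z s Ss => [|n IHn] z s Ss.
  by rewrite big_ord0 linear_fun0.
by rewrite big_ord_recl F_lin F0 // scaler0 add0r IHn.
Qed.

Lemma morita_jmin0 : formally_morita_equivalent A B ->
  (forall a : A, exists e, e ** a = a /\ a ** e = a) ->
  (forall b : B, jmin_set B b -> b = 0) ->
  forall a : A, jmin_set A a -> a = 0.
Proof.
move=> [X [f [g [[[f_lin fM _] [_ f_full]] [[[g_lin _ gC] _] rest]]]]].
move: rest => [_ [g_adj [fg [_ g_Q]]]] unitA jminB a Ja.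
pose Y := conj_bimodule X; pose k : Y -> Y -> B := g.
(* The conjugate scalars of [Y] turn antilinearity of [g] in its second argument into linearity. *)
have k_lin x : linear (k x).
  move=> z y y'; rewrite /k gC [g x y]gC [g x y']gC -[z in RHS]cbarK.
  by rewrite -astar_antilinear -g_lin.
have k_adj c x y : k (c @> x) y = k x (c ^\* @> y) by apply: g_adj.
have gxa0 x y : g (x <@ a) y = 0.
  apply: jminB; apply/jminP => rho.
  (* Property Q is property P for [Y], so a representation of B induces one of A, and that one kills
     [a]. *)
  have [sigma sigmaP] := rieffel_induction rho k_lin k_adj g_Q.
  have /jminP/(_ sigma)/sigmaP/(_ x y) := Ja.
  by rewrite g_adj.
(* By fullness [e] is a combination of values of [f], so xa = (xa)e and a = ea can be tested on such
   values. *)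
have [e [ea ae]] := unitA a.
have xa0 (x : X) : x <@ a = 0.
  rewrite -ae ractA; apply: (span_mul0 (ract_linearr (x <@ a)) f_full) => _ [y [z ->]].
  by rewrite fg gxa0 (linear_fun0 (lact_linearl z)).
rewrite -ea; apply: (span_mul0 (amul_linearl a) f_full) => _ [x [y ->]].
by rewrite -fM xa0 (linear_fun0 (f_lin x)).
Qed.

End MoritaInvariance.

(** * J_min of the quotients, local units and the conclusion *)

Lemma quot_jmin (R : realDomainType) (A : starAlgType R) (I : star_ideal A) (a : A) :
  ideal_set I `<=` jmin_set A ->
  jmin_set (quot_alg I) (quot_proj I a) <-> jmin_set A a.
Proof.
move=> I_sub; split=> /jminP Ja; apply/jminP => rho; last exact: (Ja (rep_pullback rho)).
by rewrite -(descent_proj I_sub) -[LHS]/(rep_descent I_sub rho _) Ja.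
Qed.

Lemma approximate_identity_unit (R : realDomainType) (A : starAlgType R) :
  has_approximate_identity A -> forall a : A, exists e, e ** a = a /\ a ** e = a.
Proof.
move=> [d [J [F [E [_ [_ [_ [_ [coverF [_ [_ unitE]]]]]]]]]]] a.
by have [j Fja] := coverF a; exists (E j); apply: unitE.
Qed.

Theorem proposition5p8 (R : realDomainType) (A : starAlgType R)
    (approxA : has_approximate_identity A)
    (I : star_ideal A)
    (I_sub : ideal_set I `<=` jmin_set A)
    (I_neq : ideal_set I <> jmin_set A) :
  isomorphic_categories (rep_cat (quot_alg I)) (rep_cat (quot_alg (jmin A))) /\
  isomorphic_categories (snd_rep_cat (quot_alg I))
                        (snd_rep_cat (quot_alg (jmin A))) /\
  isomorphic_closed_ideal_lattices (quot_alg I) (quot_alg (jmin A)) /\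
  ~ formally_morita_equivalent (quot_alg I) (quot_alg (jmin A)).
Proof.
have J_sub : ideal_set (jmin A) `<=` jmin_set A by [].
split; first exact: rep_cat_iso.
split; first exact: snd_rep_cat_iso.
split; first exact: closed_ideal_lattice_iso.
move=> morita; apply: I_neq; apply/seteqP; split=> // a Ja.
have proj0 (K : star_ideal A) x : quot_proj K x = 0 <-> ideal_set K x.
  by rewrite -(linear_fun0 (@quot_proj_linear _ _ K)) quot_proj_eq subr0.
(* Local units are supplied for A/I, and J_min = 0 for A/J_min(A); the class of [a] in A/I must then
   vanish, which puts [a] in I. *)
apply/proj0; apply: (morita_jmin0 morita); last exact/quot_jmin.
  move=> p; have [b <-] := quot_proj_surj p.
  have [e [eb be]] := approximate_identity_unit approxA b; exists (quot_proj I e).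
  by rewrite -[_ ** _]quot_projM eb -[_ ** _]quot_projM be.
move=> p; have [b <-] := quot_proj_surj p.
by move=> /(quot_jmin _ J_sub) Jb; apply/proj0.
Qed.
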